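(* Let $n\ge3$ and $d\ge4$ be integers and let $q$ be a prime power with $\mathrm{char}(\mathbb{F}_q)\nmid d$ and $q>(d+2)^{2(d-1)/(d-3)}$. Then for every $h\in\mathbb{F}_q[T]$ of degree $d$, $$\gamma(h,q)\le\Big\lceil\frac{\log(q^2)}{\log\big(\frac{q}{(d+2)^2}\big)}\Big\rceil.$$
   Context: For $h\in\mathbb{F}_q[T]$, $\gamma(h,q)$ denotes the minimum number $n$ of variables such that, for every $\beta\in\mathbb{F}_q$, the equation $h(X_1)+\cdots+h(X_n)=\beta$ has a solution in $\mathbb{F}_q^n$ (a generalized Waring number). *)

(* Defs.v *)
From HB Require Import structures.
From mathcomp Require Import all_boot all_order all_algebra.
From mathcomp Require Import all_classical all_reals all_analysis.

Set Implicit Arguments.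
Unset Strict Implicit.
Unset Printing Implicit Defensive.

Import Order.TTheory GRing.Theory Num.Theory.
Local Open Scope ring_scope.

Definition waring_solvable (F : finFieldType) (h : {poly F}) (m : nat) : Prop :=
  forall beta : F, exists x : 'I_m -> F, \sum_(i < m) h.[x i] = beta.

(* The value gamma(h, q), with q = #|F|, as a relation rather than a function:
   no m need be solvable (e.g. h constant), so being a Waring number includes
   the assertion that the minimum exists. *)
Definition is_waring_number (F : finFieldType) (h : {poly F}) (g : nat) : Prop :=
  waring_solvable h g /\ forall m : nat, waring_solvable h m -> (g <= m)%N.

(* Main.v *)
Require Import Defs.
From HB Require Import structures.
From mathcomp Require Import all_boot all_order all_algebra.
From mathcomp Require Import all_classical all_reals all_analysis.
From mathcomp Require Import ring lra zify.
From mathcomp Require Import cyclotomic separable finfield closed_field algC.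

Set Implicit Arguments.
Unset Strict Implicit.
Unset Printing Implicit Defensive.

Import Order.TTheory GRing.Theory Num.Theory.
Local Open Scope ring_scope.

(* Counting solutions of h(x_1) + ... + h(x_m) = beta with additive characters
   shows that m variables suffice as soon as (q - 1) ((d - 1) sqrt q)^m < q^m,
   provided every nontrivial sum S_1 of psi(h(x)) over F satisfies Weil's bound
   |S_1| <= (d - 1) sqrt q; the exponent of the statement is large enough for this.

   Weil's bound is obtained inside an algebraic closure K of F.  Let S_n be the
   analogous sum over the field with q^n elements.  The L-function, whose k-th
   coefficient is the sum over monic f of degree k of psi(sum of h over the roots
   of f), has degree < d, because adding c X^(k - d) to f shifts the sum over the
   roots by a nonzero multiple of c.  Its logarithmic derivative generates the S_n,
   so S_n = - sum w^n for at most d - 1 numbers w, and |w| <= sqrt q follows from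
   S_(2r) = O(q^r).  For the latter it is enough to bound from above the number of
   points of each curve y^q - y = h(x) - c over the field with q^(2r) elements,
   which Bombieri's version of Stepanov's method does. *)

(** * Power sums *)

(** The logarithmic derivative of [g] generates the negated power sums; this is the coefficient of
    [X ^ (n + 1)] in that relation. In the induction on [r], a new factor [1 - z X] adds a
    telescoping sum. *)
Lemma newton_identity (R : comNzRingType) (r : seq R) (n : nat) :
  let g := \prod_(z <- r) (1 - z *: 'X) in
  g`_n.+1 *+ n.+1 + \sum_(i < n.+1) (\sum_(z <- r) z ^+ i.+1) * g`_(n - i) = 0.
Proof.
elim: r n => [|z r IH] n /=.
  rewrite big_nil coefC mul0rn add0r big1 // => i _; by rewrite big_nil mul0r.
rewrite big_cons; set g0 := \prod_(j <- r) _ in IH *.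
have coefg k : ((1 - z *: 'X) * g0)`_k = g0`_k - z * ('X * g0)`_k.
  by rewrite mulrBl mul1r coefB -scalerAl coefZ.
rewrite coefg coefXM /=.
under eq_bigr => i _ do rewrite coefg big_cons mulrDl.
rewrite big_split /=.
have -> : \sum_(i < n.+1) z ^+ i.+1 * (g0`_(n - i) - z * ('X * g0)`_(n - i)) = z * g0`_n.
  pose u i := z ^+ i.+1 * ('X * g0)`_(n.+1 - i).
  rewrite -(big_mkord xpredT (fun i => z ^+ i.+1 * (g0`_(n - i) - z * ('X * g0)`_(n - i)))).
  have -> : z * g0`_n = - (u n.+1 - u 0%N).
    by rewrite /u subnn subn0 !coefXM /= mulr0 expr1 sub0r opprK.
  rewrite -(telescope_sumr u (leq0n _)) big_nat [in RHS]big_nat -sumrN.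
  apply: eq_bigr => i /andP[_ lin]; rewrite /u subSS.
  have -> : ('X * g0)`_(n.+1 - i) = g0`_(n - i) by rewrite coefXM subSn.
  by rewrite opprB mulrBr exprSr -[in RHS]mulrA [in RHS](exprSr z i.+1) [in RHS](exprSr z i) -!mulrA.
under eq_bigr => i _ do rewrite mulrBr.
rewrite sumrB /=.
have -> : \sum_(i < n.+1) (\sum_(z <- r) z ^+ i.+1) * (z * ('X * g0)`_(n - i))
   = - (z * (g0`_n *+ n)).
  rewrite big_ord_recr /= subnn coefXM /= !mulr0 addr0.
  case: n => [|m]; first by rewrite big_ord0 mulr0n mulr0 oppr0.
  have /eqP := IH m; rewrite addr_eq0 => /eqP ->.
  rewrite mulrN opprK mulr_sumr; apply: eq_bigr => i _.
  by rewrite coefXM subSn ?(ltnW (ltn_ord i)) //=; [rewrite mulrCA | rewrite -ltnS].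
have -> : \sum_(i < n.+1) (\sum_(j <- r) j ^+ i.+1) * g0`_(n - i) = - (g0`_n.+1 *+ n.+1).
  by apply/eqP; rewrite -addr_eq0 addrC; apply/eqP/IH.
rewrite mulrnBl opprK mulrnAr [(z * _) *+ n.+1]mulrSr.
move: (g0`_n.+1 *+ n.+1) (z * g0`_n *+ n) (z * g0`_n) => a b c; ring.
Qed.

(** Connects Newton's identities, which use [prod (1 - z X)], with the top coefficients of the monic
    polynomial whose roots are [r]. *)
Lemma coef_rev_prod_XsubC (R : comNzRingType) (r : seq R) (i : nat) :
  (i <= size r)%N ->
  (\prod_(z <- r) (1 - z *: 'X))`_i = (\prod_(z <- r) ('X - z%:P))`_(size r - i).
Proof.
elim: r i => [|z r IH] i /=.
  by rewrite leqn0 => /eqP ->; rewrite !big_nil.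
move=> hi; rewrite !big_cons mulrBl mul1r mulrBl !coefB -scalerAl coefZ coefCM !coefXM.
have hsz : size (\prod_(j <- r) ('X - j%:P)) = (size r).+1 by rewrite size_prod_XsubC.
case: i hi => [|i] hi /=.
  rewrite mulr0 subr0 subn0 [X in _ - z * X]nth_default ?hsz // mulr0 subr0.
  by rewrite IH // subn0.
rewrite subSS subn_eq0; case: leqP => [le|lt].
  have -> : i = size r by apply/eqP; rewrite eqn_leq le -ltnS hi.
  have sz : (size (\prod_(j <- r) (1 - j *: 'X))%R <= (size r).+1)%N.
    elim: (r) => [|y s IHs]; rewrite ?big_nil ?size_poly1 // big_cons.
    apply: leq_trans (size_polyMleq _ _) _ => /=.
    rewrite -subn1 leq_subLR; apply: (@leq_add _ _ 2 _.+1) IHs.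
    apply: leq_trans (size_polyD _ _) _; rewrite size_poly1 size_polyN geq_max /=.
    by apply: leq_trans (size_scale_leq _ _) _; rewrite size_polyX.
  by rewrite [X in X - _]nth_default // IH // subnn.
by rewrite (IH _ lt) (IH _ (ltnW lt)) subnS.
Qed.


(** Bernoulli's inequality [1 + n (x - 1) <= x ^ n], combined with the archimedean property. *)
Lemma exp_unbounded (x D : algC) (n0 : nat) :
  1 < x -> 0 <= D -> exists2 n, (n0 <= n)%N & D < x ^+ n.
Proof.
move=> x1 D0; have d0 : 0 < x - 1 by rewrite subr_gt0.
have bern n : 1 + (x - 1) *+ n <= x ^+ n.
  elim: n => [|n IH]; first by rewrite mulr0n addr0 expr0.
  rewrite exprSr; apply: le_trans (ler_wpM2r (ltW (lt_trans ltr01 x1)) IH).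
  rewrite mulrSr -subr_ge0.
  have -> : (1 + (x - 1) *+ n) * x - (1 + ((x - 1) *+ n + (x - 1))) = (x - 1) ^+ 2 *+ n.
    rewrite -[(x - 1) *+ n]mulr_natr -[(x - 1) ^+ 2 *+ n]mulr_natr.
    by move: (n%:R) => t; ring.
  by rewrite mulrn_wge0 // exprn_ge0 // ltW.
have q0 : 0 <= D / (x - 1) by rewrite divr_ge0 // ltW.
exists (maxn n0 (Num.bound (D / (x - 1)))); first exact: leq_maxl.
apply: lt_le_trans (bern _).
have h : D / (x - 1) < (Num.bound (D / (x - 1)))%:R by exact: archi_boundP.
rewrite ltr_pdivrMr // mulr_natl in h; apply: (lt_le_trans h).
rewrite -[X in X <= _]add0r lerD // ?ler01 //.
by rewrite ler_pMn2l // leq_maxr.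
Qed.

(* Applying to the sequence of power sums the polynomial that kills all the
   roots but one isolates the powers of that root. *)
Lemma power_sum_bound (s : seq algC) (B C : algC) (n0 : nat) : 0 < B ->
  (forall n, (n0 <= n)%N -> `|\sum_(w <- s) w ^+ n| <= C * B ^+ n) ->
  forall w, w \in s -> `|w| <= B.
Proof.
move=> B0 hC w0 w0s.
pose P := \prod_(y <- rem w0 (undup s)) ('X - y%:P).
have Pw0 : P.[w0] != 0.
  rewrite -/(root P w0) root_prod_XsubC mem_rem_uniq ?undup_uniq // inE eqxx.
  by [].
have Pw w : w \in s -> w != w0 -> P.[w] = 0.
  move=> ws ww; apply/eqP; rewrite -/(root P w) root_prod_XsubC.
  by rewrite mem_rem_uniq ?undup_uniq // inE ww mem_undup.
have key n : \sum_(k < size P) P`_k * (\sum_(w <- s) w ^+ (n + k)) =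
    (w0 ^+ n * P.[w0]) *+ count_mem w0 s.
  transitivity (\sum_(w <- s) w ^+ n * P.[w]).
    under eq_bigr => k _ do rewrite mulr_sumr.
    rewrite exchange_big /=; apply: eq_bigr => w _.
    rewrite horner_coef mulr_sumr; apply: eq_bigr => k _.
    by rewrite exprD mulrCA.
  rewrite (bigID (pred1 w0)) /= [X in _ + X]big1_seq ?addr0.
    rewrite -big_filter.
    rewrite (eq_big_seq (fun=> w0 ^+ n * P.[w0])); last first.
      by move=> w; rewrite mem_filter => /andP[/eqP ->].
    by rewrite big_const_seq count_predT size_filter iter_addr addr0.
  by move=> w /andP[ww ws]; rewrite Pw // mulr0.
pose D := \sum_(k < size P) `|P`_k| * (C * B ^+ k).
have bnd n : (n0 <= n)%N -> `|w0| ^+ n * `|P.[w0]| <= D * B ^+ n.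
  move=> hn; have cnt : (0 < count_mem w0 s)%N by rewrite -has_count has_pred1.
  apply: (@le_trans _ _ (`|(w0 ^+ n * P.[w0]) *+ count_mem w0 s|)).
    by rewrite normrMn normrM normrX -[X in X <= _]mulr1n ler_wpMn2l //.
  rewrite -key mulr_suml; apply: le_trans (ler_norm_sum _ _ _) _.
  apply: ler_sum => k _; rewrite normrM -mulrA ler_wpM2l //.
  by rewrite -mulrA -exprD [(k + n)%N]addnC; apply: hC; apply: leq_trans hn (leq_addr _ _).
have D0 : 0 <= D / `|P.[w0]|.
  apply: divr_ge0 => //; have := bnd n0 (leqnn _).
  move/(le_trans _) => h; have : 0 <= D * B ^+ n0 by apply: h; rewrite mulr_ge0 // exprn_ge0.
  by rewrite pmulr_lge0 // exprn_gt0.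
rewrite real_leNgt ?normr_real ?gtr0_real //; apply/negP => wB.
have [||n hn] := @exp_unbounded (`|w0| / B) (D / `|P.[w0]|) n0.
- by rewrite ltr_pdivlMr // mul1r.
- by [].
rewrite ltr_pdivrMr ?normr_gt0 // expr_div_n mulrAC ltr_pdivlMr ?exprn_gt0 //.
by move/lt_le_trans => /(_ _ (bnd n hn)); rewrite ltxx.
Qed.

(** * Stepanov's method *)

(** [vi u] and [vj u] are the exponents of the monomial [x ^ a * y ^ b] of weight [u]. As [k]
    inverts [d] modulo [q], [b] has to be [u * k %% q], and [q * d <= u] ensures [d * b <= u]. *)
Lemma weight_decomposition (q d : nat) : (0 < q)%N -> (0 < d)%N -> coprime q d ->
  exists vi vj : nat -> nat, [/\ forall u, (vj u < q)%N,
    forall a b, (b < q)%N -> vi (q * a + d * b)%N = a /\ vj (q * a + d * b)%N = b &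
    forall u, (q * d <= u)%N -> (q * vi u + d * vj u)%N = u].
Proof.
move=> q0 d0 co; have [k m e _] := egcdnP q d0.
have {}e : (k * d = m * q + 1)%N by rewrite e gcdnC (eqP co).
have hj u : d * (u * k %% q) = u %[mod q].
  rewrite modnMmr mulnCA [(d * k)%N]mulnC e mulnDr muln1 mulnA.
  by rewrite modnMDl.
exists (fun u => (u - d * (u * k %% q)) %/ q)%N, (fun u => u * k %% q)%N; split.
- by move=> u; rewrite ltn_mod.
- move=> a b hb; have -> : ((q * a + d * b) * k %% q = b)%N.
    have -> : ((q * a + d * b) * k = (a * k + b * m) * q + b)%N.
      rewrite mulnDl -[(d * b * k)%N]mulnA [(b * k)%N]mulnC mulnA [(d * k)%N]mulnC e; lia.
    by rewrite modnMDl modn_small.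
  by rewrite addnK mulKn.
- move=> u hu; have le : (d * (u * k %% q) <= u)%N.
    apply: leq_trans hu; rewrite mulnC leq_mul2r; apply/orP; right.
    by rewrite ltnW // ltn_mod.
  rewrite muln_divA.
    by rewrite mulKn // subnK.
  by rewrite -eqn_mod_dvd //; apply/eqP; rewrite hj.
Qed.

Lemma linear_dependence (K : fieldType) (I : finType) (n : nat) (a : I -> 'I_n -> K) :
  (n < #|I|)%N -> exists b : I -> K, (exists i, b i != 0) /\
    forall u, \sum_i b i * a i u = 0.
Proof.
move=> hn; pose A := \matrix_(i < #|I|, u < n) a (enum_val i) u.
have : kermx A != 0.
  rewrite kermx_eq0 /row_free; apply/eqP => h.
  by have := rank_leq_col A; rewrite h leqNgt hn.
case/rowV0Pn => r /sub_kermxP rA r0.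
exists (fun i => r 0 (enum_rank i)); split.
  have /existsP[j hj] : [exists j, r 0 j != 0].
    apply: contra_neqT r0; rewrite negb_exists => /forallP h.
    by apply/rowP => j; rewrite mxE; apply/eqP; have := h j; rewrite negbK.
  by exists (enum_val j); rewrite enum_valK.
move=> u; have /matrixP/(_ 0 u) := rA; rewrite !mxE => h.
rewrite -[RHS]h (reindex (@enum_val I xpredT)) /=; last first.
  by exists enum_rank => i _; rewrite ?enum_valK ?enum_rankK.
by apply: eq_bigr => i _; rewrite mxE enum_valK.
Qed.

(* Reduction of [y ^ k] modulo [y ^ q = y + H(x)], as a polynomial in [y] with
   coefficients in [K[x]]; [x] has weight [q] and [y] has weight [d]. *)
Lemma curve_reduction (K : fieldType) (q d : nat) (H : {poly K}) :
  (1 < q)%N -> (0 < d)%N -> size H = d.+1 ->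
  exists red : nat -> {poly {poly K}}, forall k,
    [/\ forall j i, (red k)`_j`_i != 0 -> (j < q)%N /\ (q * i + d * j <= d * k)%N,
        (red k)`_(k %% q)`_(d * (k %/ q)) != 0 &
        forall x y, y ^+ q = y + H.[x] -> (red k).[y%:P].[x] = y ^+ k].
Proof.
move=> q1 d0 sH; have q0 : (0 < q)%N by apply: ltnW.
suff h k : exists R : {poly {poly K}},
    [/\ forall j i, R`_j`_i != 0 -> (j < q)%N /\ (q * i + d * j <= d * k)%N,
        R`_(k %% q)`_(d * (k %/ q)) != 0 &
        forall x y, y ^+ q = y + H.[x] -> R.[y%:P].[x] = y ^+ k].
  by have [red hred] := boolp.choice h; exists red.
elim/ltn_ind: k => k IH; have [kq|qk] := ltnP k q.
  exists 'X^k; split.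
  - move=> j i; rewrite coefXn; have [->|_] := eqVneq j k; last by rewrite coef0 eqxx.
    by rewrite coef1; have [->|_] := eqVneq i 0%N; rewrite ?eqxx // muln0 add0n.
  - by rewrite modn_small // divn_small // muln0 coefXn eqxx coef1 oner_eq0.
  - by move=> x y _; rewrite hornerXn -polyC_exp hornerC.
have [|R1 [w1 _ e1]] := IH (k - q).+1; first by lia.
have [|R2 [w2 t2 e2]] := IH (k - q)%N; first by lia.
(* From [y ^ k = y ^ (k - q) * (y + H(x))]. *)
exists (R1 + H *: R2); split.
- move=> j i; rewrite coefD coefZ coefD => h.
  have : (R1`_j`_i != 0) \/ ((H * R2`_j)`_i != 0).
    by case: (eqVneq (R1`_j`_i) 0) h => [->|]; [rewrite add0r; right | left].
  case=> [/w1[jq hj]|]; first by split=> //; apply: leq_trans hj _; rewrite leq_mul2l; lia.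
  rewrite coefM => h1.
  have /existsP[a ha] : [exists a : 'I_i.+1, H`_a * R2`_j`_(i - a) != 0].
    apply: contra_neqT h1; rewrite negb_exists => /forallP h2.
    by apply: big1 => a _; apply/eqP; have := h2 a; rewrite negbK.
  move: ha; rewrite mulf_eq0 negb_or => /andP[ha /w2[jq hj]]; split=> //.
  have ad : (a <= d)%N.
    by rewrite leqNgt; apply: contra ha => lt; rewrite nth_default // sH.
  have ai : (a <= i)%N by rewrite -ltnS.
  have : (q * a <= q * d)%N by rewrite leq_mul2l ad orbT.
  have -> : (q * i = q * (i - a) + q * a)%N by rewrite -mulnDr subnK.
  have -> : (d * k = d * (k - q) + q * d)%N by rewrite [(q * d)%N]mulnC -mulnDr subnK.
  by move: hj; lia.
(* The monomial of full weight [d * k] comes only from the leading term of [H] times the top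
   monomial of [R2]: [R1] has weight at most [d * (k - q + 1) < d * k], and lower terms of [H] lose
   weight. *)
- rewrite coefD coefZ coefD.
  have ek : (k = (k - q) + q)%N by rewrite subnK.
  have em : (k %% q = (k - q) %% q)%N by rewrite {1}ek modnDr.
  have ed : (k %/ q = ((k - q) %/ q).+1)%N by rewrite {1}ek divnDr ?dvdnn // divnn q0 addn1.
  rewrite em ed; set e := ((k - q) %/ q)%N; set j := ((k - q) %% q)%N.
  have ekq : (k - q = e * q + j)%N by exact: divn_eq.
  have -> : R1`_j`_(d * e.+1) = 0.
    apply/eqP/negPn/negP => /w1[_]; rewrite ekq.
    have : (d < q * d)%N by rewrite -[X in (X < _)%N]mul1n ltn_mul2r d0.
    by nia.
  rewrite add0r coefM.
  have lt : (d < (d * e.+1).+1)%N by rewrite ltnS leq_pmulr.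
  rewrite (bigD1 (Ordinal lt)) //= big1 ?addr0.
    rewrite mulf_neq0 //; first by rewrite -[d]/(d.+1.-1) -sH -lead_coefE lead_coef_eq0 -size_poly_eq0 sH.
    by rewrite mulnS addKn t2.
  move=> a ne; have [->|Ha] := eqVneq (H`_a) 0; first by rewrite mul0r.
  have ad : (a < d)%N.
    rewrite ltn_neqAle; apply/andP; split.
      by apply: contra_neq ne => ad; apply: val_inj.
    by rewrite leqNgt; apply: contra Ha => lt'; rewrite nth_default // sH.
  rewrite [X in _ * X](_ : _ = 0) ?mulr0 //; apply/eqP/negPn/negP => /w2[_].
  have := subnK (ltn_ord a : (a <= d * e.+1)%N); rewrite ekq.
  move: (d * e.+1 - a)%N => t et hh.
  have /(congr1 (muln q)) : (t + a = d * e + d)%N by rewrite et mulnSr.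
  have : (q * a < q * d)%N by rewrite ltn_mul2l q0 ad.
  by move: hh; rewrite !mulnDr [(d * (e * q))%N]mulnCA [(e * (d * q))%N]mulnCA [(e * q)%N]mulnC [(q * (d * e))%N]mulnCA; lia.
- move=> x y h; rewrite hornerD hornerZ hornerD hornerM e1 // e2 //.
  by rewrite exprS -mulrDl -h -exprD subnKC.
Qed.

(* The unknowns [b] are indexed by pairs of monomials [e_v], [e_w] of weights
   [v < s] and [w <= s + 2 q d].  There are more of them than monomials of weight
   at most that of [e_v ^ s * e_w], so some nonzero [b] makes the sum of the
   [b * e_v ^ s * e_w] vanish on the curve.  With [g ^ s = b], the function
   [F0 = sum g * e_v * e_w ^ s] then has [F0 ^ s = 0] at the points rational over
   the field with [s ^ 2] elements, and it is nonzero since the weights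
   [v + s * w] are distinct.  As [F0] has degree less than [q] in [y] and vanishes
   on fibres of [q] points, all its coefficients in [K[x]] vanish on [X]. *)
Lemma stepanov_bound (K : closedFieldType) (q d s : nat) (H : {poly K}) (X : seq K) :
  (1 < q)%N -> (0 < d)%N -> coprime q d -> size H = d.+1 ->
  (forall a b : K, (a + b) ^+ s = a ^+ s + b ^+ s) -> ((q * d + 2) ^ 2 <= s)%N ->
  uniq X ->
  (forall x, x \in X -> x ^+ (s * s) = x /\ exists ys : seq K, [/\ uniq ys, size ys = q &
     forall y, y \in ys -> y ^+ (s * s) = y /\ y ^+ q = y + H.[x]]) ->
  (q * size X <= s * s + (2 * (q * d) + 1) * s)%N.
Proof.
move=> q1 d0 co sH frob ls uX hX; have q0 : (0 < q)%N by apply: ltnW.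
have [vi [vj [vjq vij vd]]] := weight_decomposition q0 d0 co.
have [red hred] := curve_reduction q1 d0 sH.
pose mon i k := 'X^i *: red k.
have mon1 i k j' i' : (mon i k)`_j'`_i' != 0 -> (j' < q)%N /\ (q * i' + d * j' <= q * i + d * k)%N.
  rewrite coefZ coefXnM; case: ltnP => [_|le]; first by rewrite eqxx.
  have [h _ _] := hred k; case/h => -> h1; split=> //.
  have -> : (q * i' = q * (i' - i) + q * i)%N by rewrite -mulnDr subnK.
  by move: h1; lia.
have mon2 i k : exists i' j', [/\ (j' < q)%N, (q * i' + d * j' = q * i + d * k)%N &
    (mon i k)`_j'`_i' != 0].
  exists (i + d * (k %/ q))%N, (k %% q)%N; split; first by rewrite ltn_mod.
    rewrite [in RHS](divn_eq k q) !mulnDr -addnA; congr (_ + (_ + _))%N.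
    by rewrite mulnCA [(_ * q)%N]mulnC.
  by rewrite coefZ coefXnM ltnNge leq_addr /= addKn; have [_ ->] := hred k.
have mon3 i k x y : y ^+ q = y + H.[x] -> (mon i k).[y%:P].[x] = x ^+ i * y ^+ k.
  move=> h; rewrite hornerZ hornerM hornerXn; congr (_ * _).
  by have [_ _ ->] := hred k.
(* From [c] on, every weight belongs to exactly one monomial of degree below [q] in [y], so both
   ranges of weights start at [c]. *)
set c := (q * d)%N in ls *.
have lc : (c < s)%N by move: ls; nia.
have s0 : (0 < s)%N by apply: leq_ltn_trans lc.
pose M := (s + c.+1)%N; pose L := (s - c)%N.
pose m := (s + 2 * c)%N; pose l := s.-1.
pose w (i : 'I_M) := (c + i)%N; pose v (j : 'I_L) := (c + j)%N.
have wm i : (w i <= m)%N by have := ltn_ord i; rewrite /w /m /M; lia.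
have vl j : (v j <= l)%N by have := ltn_ord j; rewrite /v /l /L; lia.
pose W := (s * l + m).+1.
(* [M * L = s ^ 2 + s - c ^ 2 - c] exceeds [W = s ^ 2 + 2 c + 1] because [s >= (c + 2) ^ 2]. *)
have hW : (W < #|{: 'I_M * 'I_L}|)%N.
  rewrite card_prod !card_ord /W /M /L /m /l.
  have : exists t, s = ((c + 2) ^ 2 + t)%N by exists (s - (c + 2) ^ 2)%N; rewrite subnKC.
  case=> t et; have -> : (s.-1 = c * c + 4 * c + 3 + t)%N by rewrite et; lia.
  have -> : (s - c = c * c + 3 * c + 4 + t)%N by rewrite et; lia.
  by rewrite et; nia.
pose E (ij : 'I_M * 'I_L) :=
  mon (s * vi (v ij.2) + vi (w ij.1))%N (s * vj (v ij.2) + vj (w ij.1))%N.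
have EW ij j' i' : (E ij)`_j'`_i' != 0 -> (j' < q)%N /\ (q * i' + d * j' < W)%N.
  case/mon1 => -> h; split=> //; rewrite /W ltnS; apply: leq_trans h _.
  have h1 := vd _ (leq_addr ij.1 c : (c <= w ij.1)%N).
  have h2 := vd _ (leq_addr ij.2 c : (c <= v ij.2)%N).
  have h3 : (s * v ij.2 <= s * l)%N by rewrite leq_mul2l vl orbT.
  apply: leq_trans (leq_add h3 (wm ij.1)).
  rewrite -[X in (_ <= s * X + _)%N]h2 -[X in (_ <= _ + X)%N]h1.
  by move: (vi _) (vi _) (vj _) (vj _) => a1 a2 a3 a4; lia.
have [b [[ij0 bij0] hb]] := linear_dependence (fun ij (u : 'I_W) => (E ij)`_(vj u)`_(vi u)) hW.
have G0 x y : y ^+ q = y + H.[x] -> \sum_ij b ij * (E ij).[y%:P].[x] = 0.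
  move=> hxy.
  (* A monomial with [j' < q] is determined by its weight, so the [W] equations control every
     coefficient. *)
  have : \sum_ij (b ij)%:P *: E ij = 0.
    apply/polyP => j'; rewrite coef0 coef_sum; apply/polyP => i'.
    rewrite coef0 coef_sum.
    under eq_bigr => ij _ do rewrite coefZ coefCM.
    have [/forallP h|] := boolP [forall ij, (E ij)`_j'`_i' == 0].
      by apply: big1 => ij _; rewrite (eqP (h ij)) mulr0.
    rewrite negb_forall => /existsP[ij /EW[j'q hw]].
    have [ei ej] := vij i' j' j'q.
    have := hb (Ordinal hw); rewrite /= ei ej; exact.
  move/(congr1 (fun P : {poly {poly K}} => P.[y%:P].[x])).
  rewrite !horner0 horner_sum horner_sum => h; rewrite -[RHS]h.
  by apply: eq_bigr => ij _; rewrite [in RHS]hornerZ hornerCM.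
have root_s (a : K) : exists z, z ^+ s == a.
  have /closed_rootP[z] : size ('X^s - a%:P) != 1%N.
    by rewrite size_XnsubC // eqSS -lt0n.
  by rewrite rootE !hornerE subr_eq0 => hz; exists z.
pose g ij := xchoose (root_s (b ij)).
have hg ij : g ij ^+ s = b ij by apply/eqP/(xchooseP (root_s (b ij))).
have frob_sum (I : finType) (f : I -> K) : (\sum_i f i) ^+ s = \sum_i f i ^+ s.
  apply: (big_morph (fun a => a ^+ s)) => //.
  by rewrite expr0n -[s == 0%N]negbK -lt0n s0.
pose F0e (ij : 'I_M * 'I_L) :=
  mon (vi (v ij.2) + s * vi (w ij.1))%N (vj (v ij.2) + s * vj (w ij.1))%N.
pose F0 := \sum_ij (g ij)%:P *: F0e ij.
pose wt (ij : 'I_M * 'I_L) := (v ij.2 + s * w ij.1)%N.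
have F0ewt ij : (q * (vi (v ij.2) + s * vi (w ij.1)) + d * (vj (v ij.2) + s * vj (w ij.1)) = wt ij)%N.
  have h1 := vd _ (leq_addr ij.1 c : (c <= w ij.1)%N).
  have h2 := vd _ (leq_addr ij.2 c : (c <= v ij.2)%N).
  rewrite /wt -[X in (_ = X + _)%N]h2 -[X in (_ = _ + s * X)%N]h1.
  by move: (vi _) (vi _) (vj _) (vj _) => a1 a2 a3 a4; lia.
have gij0 : g ij0 != 0.
  by apply: contraNneq bij0 => h; rewrite -hg h expr0n -[s == 0%N]negbK -lt0n s0.
have F0coef j' i' : F0`_j'`_i' = \sum_ij g ij * (F0e ij)`_j'`_i'.
  by rewrite coef_sum coef_sum; apply: eq_bigr => ij _; rewrite coefZ coefCM.
have [j' [i' [j'q F0n]]] : exists j' i', (j' < q)%N /\ F0`_j'`_i' != 0.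
  (* The top monomial of the term of largest weight survives: [v < s] lets [v + s * w] determine the
     pair, so no other term with [g ij != 0] reaches this weight. *)
  pose ij1 := [arg max_(ij > ij0 | g ij != 0) wt ij].
  have [gij1 max1] : g ij1 != 0 /\ forall ij, g ij != 0 -> (wt ij <= wt ij1)%N.
    by rewrite /ij1; case: arg_maxnP.
  have [i' [j' [j'q hw hn]]] := mon2 (vi (v ij1.2) + s * vi (w ij1.1))%N (vj (v ij1.2) + s * vj (w ij1.1))%N.
  exists j', i'; split=> //; rewrite F0coef (bigD1 ij1) //= big1 ?addr0 ?mulf_neq0 //.
  move=> ij ne; have [->|gn] := eqVneq (g ij) 0; first by rewrite mul0r.
  rewrite [X in _ * X](_ : _ = 0) ?mulr0 //; apply/eqP/negPn/negP => /mon1[_].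
  rewrite hw !F0ewt => le1; have := max1 _ gn => le2.
  have e : wt ij = wt ij1 by apply/eqP; rewrite eqn_leq le1 le2.
  have v1 := vl ij.2; have v2 := vl ij1.2.
  have vs k : (v k < s)%N by rewrite -(prednK s0) ltnS vl.
  have ew : w ij.1 = w ij1.1.
    have := congr1 (fun t => t %/ s)%N e; rewrite /wt !(addnC (v _)) ![(s * _)%N]mulnC.
    by rewrite !divnMDl // !divn_small // !addn0.
  have ev : v ij.2 = v ij1.2 by move: e; rewrite /wt ew => /addIn.
  case/negP: ne; apply/eqP; case: (ij) (ij1) ew ev => [a1 a2] [b1 b2] /=.
  by move=> /addnI /val_inj -> /addnI /val_inj ->.
have F0w j2 i2 : F0`_j2`_i2 != 0 -> (j2 < q)%N /\ (q * i2 <= l + s * m)%N.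
  rewrite F0coef => h.
  have /existsP[ij hij] : [exists ij, g ij * (F0e ij)`_j2`_i2 != 0].
    apply: contra_neqT h; rewrite negb_exists => /forallP h.
    by apply: big1 => a _; apply/eqP; have := h a; rewrite negbK.
  move: hij; rewrite mulf_eq0 negb_or => /andP[_ /mon1[-> ]]; rewrite F0ewt => hw.
  split=> //; apply: (@leq_trans (wt ij)); first by move: hw; lia.
  by rewrite leq_add ?vl // leq_mul2l wm orbT.
have szF0 : (size F0 <= q)%N.
  apply/leq_sizeP => j qj; apply/polyP => i; rewrite coef0; apply/eqP/negPn/negP => /F0w[].
  by rewrite ltnNge qj.
have vanish x : x \in X -> root F0`_j' x.
  case/hX => xQ [ys [uys sys hys]].
  pose P := map_poly (horner_eval x) F0.
  have P0 : P = 0.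
    apply: (roots_geq_poly_eq0 _ uys); last first.
      by rewrite sys; apply: leq_trans szF0; apply: size_poly.
    apply/allP => y /hys[yQ yq]; rewrite rootE.
    have -> : P.[y] = F0.[y%:P].[x].
      rewrite -[in LHS](hornerC y x) -[_.[x]]/(horner_eval x y%:P) horner_map.
      by [].
    have : F0.[y%:P].[x] ^+ s = 0.
      rewrite -(G0 x y yq) horner_sum horner_sum frob_sum; apply: eq_bigr => ij _.
      rewrite [in LHS]hornerZ [in LHS]hornerCM exprMn hg; congr (_ * _).
      (* On the field with [s ^ 2] elements, the power [s] swaps the roles of the two exponents and
         turns the terms of [F0] into those of the vanishing sum. *)
      have pw z i k : z ^+ (s * s) = z -> (z ^+ (i + s * k)) ^+ s = z ^+ (s * i + k).
        move=> hz; rewrite -exprM (_ : ((i + s * k) * s = s * i + s * s * k)%N); last lia.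
        by rewrite exprD [z ^+ (s * s * k)]exprM hz -exprD.
      by rewrite /F0e /E !mon3 // exprMn !pw.
    by move/eqP; rewrite expf_eq0 => /andP[].
  rewrite rootE; have := congr1 (fun p : {poly K} => p`_j') P0.
  by rewrite coef_map coef0 /= => <-.
have Fj0 : F0`_j' != 0 by apply: contraNneq F0n => ->; rewrite coef0.
have szX : (size X < size (F0`_j')%R)%N.
  have aX : all (root F0`_j') X by apply/allP; exact: vanish.
  exact: max_poly_roots Fj0 aX uX.
have := lead_coef_eq0 F0`_j'; rewrite (negbTE Fj0) lead_coefE => /negbT /F0w[_ hw].
(* The weight of the leading monomial bounds [q] times the degree of this coefficient by
   [l + s * m]. *)
apply: (@leq_trans (q * (size (F0`_j')%R).-1)%N).
  by rewrite leq_mul2l -ltnS prednK ?szX ?orbT // (leq_ltn_trans _ szX).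
apply: leq_trans hw _; rewrite /l /m mulnDr; nia.
Qed.

(** * Descent from an algebraic closure *)

Section FrobeniusDescent.

Variables (F : finFieldType) (K : closedFieldType) (emb : {rmorphism F -> K}).
Local Notation q := #|F|.

Lemma pnat_pchar_card n : [pchar K].-nat (q ^ n)%N.
Proof.
have [p pp pF] := finPcharP F.
have pK : p \in [pchar K] by rewrite (fmorph_pchar emb).
rewrite pnatX; apply/orP; left.
rewrite (eq_pnat _ (pcharf_eq pK)).
by have := abelian.abelem_pgroup (abelian.fin_ring_pchar_abelem pF); rewrite /pgroup.pgroup cardsT.
Qed.

Lemma card_field_gt1 : (1 < q)%N. Proof. exact: finNzRing_gt1. Qed.

Lemma card_field_gt0 n : (0 < q ^ n)%N.
Proof. by rewrite expn_gt0 ltnW // card_field_gt1. Qed.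

Lemma exprD_card n (x y : K) : (x + y) ^+ (q ^ n) = x ^+ (q ^ n) + y ^+ (q ^ n).
Proof. exact/exprDn_pchar/pnat_pchar_card. Qed.

Lemma exprN_card n (x : K) : (- x) ^+ (q ^ n) = - x ^+ (q ^ n).
Proof.
apply/eqP; rewrite -addr_eq0 -exprD_card addrC subrr expr0n.
by rewrite -[_ == 0%N]negbK -lt0n card_field_gt0.
Qed.

Lemma exprB_card n (x y : K) : (x - y) ^+ (q ^ n) = x ^+ (q ^ n) - y ^+ (q ^ n).
Proof. by rewrite exprD_card exprN_card. Qed.

Lemma expr_card_inj n : injective (fun x : K => x ^+ (q ^ n)).
Proof.
move=> x y /eqP; rewrite -subr_eq0 -exprB_card expf_eq0 => /andP[_].
by rewrite subr_eq0 => /eqP.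
Qed.

Definition frob (x : K) : K := x ^+ q.

Lemma frob_is_zmod_morphism : zmod_morphism frob.
Proof. by move=> x y; rewrite /frob -[q]expn1 exprB_card. Qed.
Lemma frob_is_monoid_morphism : monoid_morphism frob.
Proof. by split=> [|x y]; rewrite /frob ?expr1n ?exprMn. Qed.
HB.instance Definition _ := GRing.isZmodMorphism.Build K K frob frob_is_zmod_morphism.
HB.instance Definition _ := GRing.isMonoidMorphism.Build K K frob frob_is_monoid_morphism.

Lemma emb_card n a : emb a ^+ (q ^ n) = emb a.
Proof. by rewrite -rmorphXn; congr (emb _); elim: n => // n IH; rewrite expnS exprM expf_card. Qed.

(** Brings elements fixed by [frob] back into [F]; the value off the image of [emb] is the default
    [0]. *)
Definition emb_inv (z : K) : F := odflt 0 [pick a | emb a == z].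

Lemma embK : cancel emb emb_inv.
Proof.
move=> a; rewrite /emb_inv; case: pickP => [b /eqP/fmorph_inj //|/(_ a)].
by rewrite eqxx.
Qed.

(** A fixed point of [frob] is a root of [X ^ q - X], which is the product of the [X - a] over [a]
    in [F]. *)
Lemma emb_invK z : frob z = z -> emb (emb_inv z) = z.
Proof.
move=> hz; suff [a <-] : exists a, emb a = z by rewrite embK.
have : root (map_poly emb ('X^q - 'X)) z.
  by rewrite rmorphB /= map_polyXn map_polyX rootE !hornerE -/(frob z) hz subrr.
rewrite finField_genPoly map_prod_XsubC.
rewrite -(big_map emb xpredT (fun x => 'X - x%:P)) root_prod_XsubC.
by case/mapP => a _ ->; exists a.
Qed.

Definition poly_descent (p : {poly K}) : {poly F} := \poly_(i < size p) emb_inv p`_i.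

Lemma poly_descentK p : map_poly frob p = p -> map_poly emb (poly_descent p) = p.
Proof.
move=> hp; apply/polyP => i; rewrite coef_map coef_poly /=.
case: ltnP => h; last by rewrite rmorph0 nth_default.
by apply: emb_invK; rewrite -coef_map hp.
Qed.

(** * Roots, finite subfields and norm polynomials *)

Definition roots (p : {poly K}) : seq K := sval (closed_field_poly_normal p).

Lemma rootsE p : p \is monic -> p = \prod_(z <- roots p) ('X - z%:P).
Proof.
rewrite /roots => pm; case: closed_field_poly_normal => r /= e; rewrite {1}e.
by rewrite (monicP pm) scale1r.
Qed.

Lemma mem_roots p z : p \is monic -> (z \in roots p) = root p z.
Proof. by move=> pm; rewrite [in RHS](rootsE pm) root_prod_XsubC. Qed.

Lemma size_roots p : p \is monic -> size p = (size (roots p)).+1.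
Proof. by move=> pm; rewrite {1}(rootsE pm) size_prod_XsubC. Qed.

Lemma perm_roots p r : p = \prod_(z <- r) ('X - z%:P) -> perm_eq (roots p) r.
Proof.
move=> e; apply: prod_XsubC_eq; rewrite -e -rootsE // e; exact: monic_prod_XsubC.
Qed.

(** For [n > 0] these are the elements of the subfield of [K] with [q ^ n] elements. *)
Definition fixed_points n : seq K := roots ('X^(q ^ n) - 'X).

Lemma monic_fixed_poly n : (0 < n)%N -> ('X^(q ^ n) - 'X : {poly K}) \is monic.
Proof.
move=> n0; rewrite monicE lead_coefDl ?lead_coefXn // size_polyN size_polyX size_polyXn.
by rewrite ltnS -[X in (X < _)%N](expn0 q) ltn_exp2l // card_field_gt1.
Qed.

Lemma mem_fixed_points n z : (0 < n)%N -> (z \in fixed_points n) = (z ^+ (q ^ n) == z).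
Proof.
by move=> n0; rewrite mem_roots ?monic_fixed_poly // rootE !hornerE subr_eq0.
Qed.

(** The derivative of [X ^ (q ^ n) - X] is [-1], so the polynomial is separable. *)
Lemma uniq_fixed_points n : (0 < n)%N -> uniq (fixed_points n).
Proof.
move=> n0; rewrite -separable_prod_XsubC -rootsE ?monic_fixed_poly //.
have q0 : (q ^ n)%:R = 0 :> K.
  have [p pp pF] := finPcharP F.
  have pK : p \in [pchar K] by rewrite (fmorph_pchar emb).
  apply/eqP; rewrite -(dvdn_pcharf pK) Euclid_dvdX // n0 andbT.
  have := pnat_pchar_card 1; rewrite expn1 (eq_pnat _ (pcharf_eq pK)).
  case/p_natP => m hm; move: card_field_gt1; rewrite hm; case: m {hm} => // m _.
  by rewrite dvdn_exp.
rewrite unlock derivB derivXn derivX -mulr_natr -polyC_natr q0 mulr0 sub0r.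
by rewrite -(scaleN1r (1 : {poly K})) coprimepZr ?oppr_eq0 ?oner_eq0 // coprimep1.
Qed.

(** The norm of [X - a] down to [F[X]], when [a] lies in the field with [q ^ j] elements. *)
Definition norm_poly j (a : K) : {poly K} := \prod_(i < j) ('X - (a ^+ (q ^ i))%:P).

Lemma norm_poly_monic j a : norm_poly j a \is monic.
Proof. exact: monic_prod_XsubC. Qed.

Lemma size_norm_poly j a : size (norm_poly j a) = j.+1.
Proof. by rewrite /norm_poly size_prod_XsubC /index_enum -enumT size_enum_ord. Qed.

Lemma exprM_card m n (a : K) : a ^+ (q ^ (m + n)) = (a ^+ (q ^ m)) ^+ (q ^ n).
Proof. by rewrite expnD exprM. Qed.

Lemma norm_polyD e j a : a ^+ (q ^ e) = a ->
  norm_poly (e + j) a = norm_poly e a * norm_poly j a.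
Proof.
move=> ae; rewrite /norm_poly big_split_ord /=; congr (_ * _).
by apply: eq_bigr => i _; rewrite exprM_card ae.
Qed.

(** [frob] permutes the factors cyclically. *)
Lemma norm_poly_frob j a : a ^+ (q ^ j) = a -> map_poly frob (norm_poly j a) = norm_poly j a.
Proof.
move=> aj; rewrite /norm_poly map_prod_XsubC.
have fr i : frob (a ^+ (q ^ i)) = a ^+ (q ^ i.+1) by rewrite /frob -exprM -expnSr.
under eq_bigr => i _ do rewrite /= fr.
case: j aj => [|j] aj; first by rewrite !big_ord0.
by rewrite big_ord_recr [RHS]big_ord_recl /= aj expn0 expr1 mulrC.
Qed.

Lemma root_frob (f : {poly F}) a : root (map_poly emb f) a ->
  root (map_poly emb f) (frob a).
Proof.
rewrite !rootE => /eqP h; have -> : map_poly emb f = map_poly frob (map_poly emb f).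
  by apply/polyP => i; rewrite !coef_map /= /frob -[q]expn1 emb_card.
by rewrite horner_map h rmorph0.
Qed.

Lemma root_frob_iter (f : {poly F}) a i : root (map_poly emb f) a ->
  root (map_poly emb f) (a ^+ (q ^ i)).
Proof.
move=> h; elim: i => [|i IH]; first by rewrite expn0 expr1.
by rewrite expnSr exprM root_frob.
Qed.

(** The iterates of [frob] at [a] are all roots of [f], so two of them coincide; injectivity of the
    power map cancels the smaller exponent. *)
Lemma root_period (f : {poly F}) a : f != 0 -> root (map_poly emb f) a ->
  exists2 e, (0 < e)%N & a ^+ (q ^ e) = a.
Proof.
move=> f0 fa; set g := map_poly emb f.
have g0 : g != 0 by rewrite map_poly_eq0.
pose s := [seq a ^+ (q ^ i) | i <- iota 0 (size g)].
have : ~~ uniq s.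
  apply/negP => us; have : all (root g) s by apply/allP => _ /mapP[i _ ->]; apply: root_frob_iter.
  by move=> /max_poly_roots /(_ us); move/(_ g0); rewrite size_map size_iota ltnn.
case/(uniqPn 0) => i [j [ij]]; rewrite size_map size_iota => js.
rewrite !(nth_map 0%N) ?size_iota // ?(ltn_trans ij) // !nth_iota ?(ltn_trans ij) // !add0n.
move=> e; exists (j - i)%N; first by rewrite subn_gt0.
apply/(@expr_card_inj i); rewrite -exprM_card subnK ?e //; exact: ltnW.
Qed.

Lemma minimal_period (a : K) : (exists2 e, (0 < e)%N & a ^+ (q ^ e) = a) ->
  exists e, [/\ (0 < e)%N, a ^+ (q ^ e) = a,
    forall j, (0 < j < e)%N -> a ^+ (q ^ j) != a &
    uniq [seq a ^+ (q ^ i) | i <- iota 0 e]].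
Proof.
case=> e0 e00 he0; have ex : exists e, (0 < e)%N && (a ^+ (q ^ e) == a).
  by exists e0; rewrite e00 he0 eqxx.
have [e /andP[e1 /eqP ae] emin] := ex_minnP ex; exists e.
have hmin j : (0 < j < e)%N -> a ^+ (q ^ j) != a.
  case/andP=> j0 je; apply/negP => h; have := emin j; rewrite j0 h => /(_ isT).
  by rewrite leqNgt je.
split=> //; apply/(uniqPn 0) => -[i [j [ij]]]; rewrite size_map size_iota => js.
rewrite !(nth_map 0%N) ?size_iota // ?(ltn_trans ij) // !nth_iota ?(ltn_trans ij) // !add0n.
move=> h; have /negP : a ^+ (q ^ (j - i)) != a.
  by apply: hmin; rewrite subn_gt0 ij /= (leq_ltn_trans (leq_subr _ _)).
case; apply/eqP/(@expr_card_inj i); rewrite -exprM_card subnK ?h //; exact: ltnW.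
Qed.

(* The exponent of [a] in [f] counts the [j] such that [a] lies in the field with
   [q ^ j] elements and its norm polynomial from there divides [f]: those [j] are
   the multiples [e * l] of the degree [e] of [a], with the [l]-th power of the
   minimal polynomial of [a] dividing [f]. *)
Lemma count_norm_poly (f : {poly F}) (a : K) k : f \is monic -> size f = k.+1 ->
  (\sum_(1 <= j < k.+1) ((a \in fixed_points j) && (norm_poly j a %| map_poly emb f)%R) =
   mup a (map_poly emb f))%N.
Proof.
elim/ltn_ind: k f => k IH f fm sf; set g := map_poly emb f.
have f0 : f != 0 by rewrite -size_poly_eq0 sf.
have [ga|nga] := boolP (root g a); last first.
  rewrite mupNroot // big_nat big1 // => j /andP[j1 _]; apply/eqP; rewrite eqb0.
  apply/negP => /andP[_] h; case/negP: nga; rewrite -dvdp_XsubCl.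
  apply: dvdp_trans h; case: j j1 => // j _.
  by rewrite /norm_poly big_ord_recl /= expn0 expr1 dvdp_mulr.
have [e [e0 ae emin ue]] := minimal_period (root_period f0 ga).
have Ms : norm_poly e a = \prod_(z <- [seq a ^+ (q ^ i) | i <- iota 0 e]) ('X - z%:P).
  by rewrite big_map /norm_poly -(big_mkord xpredT (fun i => 'X - (a ^+ (q ^ i))%:P)) /index_iota subn0.
pose m := poly_descent (norm_poly e a).
have hm : map_poly emb m = norm_poly e a by apply/poly_descentK/norm_poly_frob.
have mg : norm_poly e a %| g.
  rewrite Ms; apply: uniq_roots_dvdp; last by rewrite uniq_rootsE.
  by apply/allP => _ /mapP[i _ ->]; apply: root_frob_iter.
have mm : m \is monic by rewrite -(map_monic emb) hm norm_poly_monic.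
have m0 : m != 0 by apply: monic_neq0.
have fE : f = m * (f %/ m).
  by rewrite mulrC divpK // -(dvdp_map emb) hm.
set f' := f %/ m in fE.
have fm' : f' \is monic by have := fm; rewrite fE monicMl.
have f'0 : f' != 0 by apply: monic_neq0.
have sm : size m = e.+1 by rewrite -(size_map_poly emb) hm size_norm_poly.
have ek : (e <= k)%N.
  have := dvdp_mulr f' (dvdpp m); rewrite -fE => /(dvdp_leq f0).
  by rewrite sf sm ltnS.
have sf' : size f' = (k - e).+1.
  have := sf; rewrite fE size_mul // sm addSn /= => h.
  by apply/eqP; rewrite -(eqn_add2l e) h addnS subnKC.
have gE : g = norm_poly e a * map_poly emb f' by rewrite -hm -rmorphM -fE.
have M0 : norm_poly e a != 0 by apply/monic_neq0/norm_poly_monic.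
have g'0 : map_poly emb f' != 0 by rewrite map_poly_eq0.
rewrite gE mupM // Ms mu_prod_XsubC count_uniq_mem //.
have -> : a \in [seq a ^+ (q ^ i) | i <- iota 0 e].
  by apply/mapP; exists 0%N; rewrite ?mem_iota ?expn0 ?expr1.
have lt : (k - e < k)%N by rewrite ltn_subrL e0 (leq_trans e0).
rewrite -(IH _ lt f' fm' sf').
(* Indices [j < e] contribute nothing, [j = e] contributes the multiplicity [1] of [a] in its
   minimal polynomial, and [j = e + j'] reduces to [j'] for [f'] after cancelling
   [norm_poly e a]. *)
rewrite (@big_cat_nat _ _ _ e) //=; last by apply: leqW.
rewrite big_nat big1 ?add0n; last first.
  move=> j /andP[j1 je]; rewrite mem_fixed_points //.
  by have := emin j; rewrite j1 je => /(_ isT) /negbTE ->.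
rewrite big_ltn ?ltnS // mem_fixed_points // ae eqxx /= -Ms dvdp_mulr //.
congr (_ + _)%N; rewrite -[in LHS](addn1 e) addnC big_addn subSn //.
rewrite big_nat [RHS]big_nat; apply: eq_bigr => j /andP[j1 _].
rewrite !mem_fixed_points ?addn_gt0 ?j1 // addnC exprM_card ae norm_polyD //.
by rewrite dvdp_mul2l.
Qed.

(** * Sums over the roots of monic polynomials *)

Definition root_sum (h f : {poly F}) : K :=
  \sum_(z <- roots (map_poly emb f)) (map_poly emb h).[z].

Lemma root_sum_perm h f r : map_poly emb f = \prod_(z <- r) ('X - z%:P) ->
  root_sum h f = \sum_(z <- r) (map_poly emb h).[z].
Proof. by move=> /perm_roots; apply: perm_big. Qed.

Lemma root_sumM h f g : f \is monic -> g \is monic ->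
  root_sum h (f * g) = root_sum h f + root_sum h g.
Proof.
move=> fm gm; rewrite /root_sum -big_cat; apply: root_sum_perm.
by rewrite rmorphM big_cat /= -!rootsE ?map_monic.
Qed.

Lemma map_frob_emb (f : {poly F}) : map_poly frob (map_poly emb f) = map_poly emb f.
Proof. by apply/polyP => i; rewrite !coef_map /= /frob -[q]expn1 emb_card. Qed.

(** [frob] permutes the roots of [f] and commutes with [h]; hence the sum lies in [F]. *)
Lemma root_sum_frob h f : f \is monic -> frob (root_sum h f) = root_sum h f.
Proof.
move=> fm; rewrite /root_sum rmorph_sum /=.
have e : map_poly emb f = \prod_(z <- map frob (roots (map_poly emb f))) ('X - z%:P).
  by rewrite big_map -(map_prod_XsubC frob) -rootsE ?map_monic // map_frob_emb.
transitivity (root_sum h f); last by [].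
rewrite (root_sum_perm h e) big_map.
apply: eq_bigr => z _.
by rewrite -(horner_map frob) /= map_frob_emb.
Qed.

Lemma root_sum_embK h f : f \is monic -> emb (emb_inv (root_sum h f)) = root_sum h f.
Proof. by move=> fm; apply/emb_invK/root_sum_frob. Qed.

(** Vectors of lower coefficients encode the monic polynomials of degree [k], which makes sums over
    them finite and lets translation act on them. *)
Definition monp k (v : 'rV[F]_k) : {poly F} := 'X^k + rVpoly v.

Lemma size_rVpoly_le k (v : 'rV[F]_k) : (size (rVpoly v) <= k)%N.
Proof. exact: size_poly. Qed.

Lemma size_monp k (v : 'rV[F]_k) : size (monp v) = k.+1.
Proof. by rewrite /monp size_polyDl size_polyXn // ltnS size_rVpoly_le. Qed.

Lemma monp_monic k (v : 'rV[F]_k) : monp v \is monic.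
Proof.
by rewrite monicE /monp lead_coefDl ?lead_coefXn // size_polyXn ltnS size_rVpoly_le.
Qed.

Definition monp_inv k (f : {poly F}) : 'rV[F]_k := poly_rV (f - 'X^k).

Lemma monpK k : cancel (@monp k) (@monp_inv k).
Proof.
move=> v; rewrite /monp_inv /monp.
have -> : 'X^k + rVpoly v - 'X^k = rVpoly v by rewrite [LHS]addrAC subrr add0r.
exact: rVpolyK.
Qed.

Lemma monp_invK k f : f \is monic -> size f = k.+1 -> monp (monp_inv k f) = f.
Proof.
move=> fm sf; rewrite /monp /monp_inv poly_rV_K; first by rewrite [LHS]addrC subrK.
apply/leq_sizeP => j; rewrite leq_eqVlt => /orP[/eqP <-|kj].
  rewrite coefB coefXn eqxx -[k in f`_k]/(k.+1.-1) -sf -lead_coefE (monicP fm).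
  by rewrite subrr.
by rewrite coefB coefXn gtn_eqF // nth_default ?subr0 // sf.
Qed.

Lemma rev_coef_monp k (v : 'rV[F]_k) i : (i <= k)%N ->
  (\prod_(z <- roots (map_poly emb (monp v))) (1 - z *: 'X))`_i = emb (monp v)`_(k - i).
Proof.
move=> ik; have fm : map_poly emb (monp v) \is monic by rewrite map_monic monp_monic.
have sr : size (roots (map_poly emb (monp v))) = k.
  by apply/eqP; rewrite -eqSS -size_roots // size_map_poly size_monp.
by rewrite coef_rev_prod_XsubC sr // -rootsE // coef_map.
Qed.

(** Among the coefficients [0] to [d] of the reversed polynomial only the [d]-th changes, by
    [emb c]; Newton's identities carry this over to the power sums. *)
Lemma power_sums_shift k d (v w : 'rV[F]_k) (c : F) : (0 < d)%N -> (d <= k)%N ->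
  monp w = monp v + c *: 'X^(k - d) ->
  let p u n := \sum_(z <- roots (map_poly emb (@monp k u))) z ^+ n in
  (forall n, (n < d)%N -> p w n = p v n) /\ p w d = p v d - emb c *+ d.
Proof.
move=> d0 dk e p.
pose g u := \prod_(z <- roots (map_poly emb (@monp k u))) (1 - z *: 'X).
have gi u i : (i <= k)%N -> (g u)`_i = emb (monp u)`_(k - i) by move=> ik; apply: rev_coef_monp.
have g0 u : (g u)`_0 = 1.
  rewrite gi // subn0 /monp coefD coefXn eqxx nth_default ?size_rVpoly_le //.
  by rewrite addr0 rmorph1.
have gg i : (i < d)%N -> (g w)`_i = (g v)`_i.
  move=> id; have ik : (i <= k)%N by apply: leq_trans dk; apply: ltnW.
  rewrite !gi // e coefD coefZ coefXn eqn_sub2lE //.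
  by rewrite (ltn_eqF id) mulr0 addr0.
have gd : (g w)`_d = (g v)`_d + emb c.
  by rewrite !gi // e coefD coefZ coefXn eqxx mulr1 rmorphD.
have newton u n : p u n.+1 = - ((g u)`_n.+1 *+ n.+1) - \sum_(i < n) p u i.+1 * (g u)`_(n - i).
  have := newton_identity (roots (map_poly emb (@monp k u))) n.
  rewrite /= -/(g u) big_ord_recr /= subnn g0 mulr1 -/(p u n.+1) => /eqP.
  rewrite addrA addr_eq0 => /eqP; rewrite -/(p u) => h.
  by apply/eqP; rewrite -opprD eq_sym eqr_oppLR; apply/eqP.
have pl n : (n < d)%N -> p w n = p v n.
  elim/ltn_ind: n => -[|n] IH nd.
    suff p0 u : p u 0%N = k%:R by rewrite !p0.
    have sz : size (roots (map_poly emb (monp u))) = k.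
      by apply/eqP; rewrite -eqSS -size_roots ?map_monic ?monp_monic // size_map_poly size_monp.
    rewrite /p; under eq_bigr => z _ do rewrite expr0.
    by rewrite big_const_seq count_predT sz iter_addr addr0.
  rewrite !newton gg //; congr (_ - _); apply: eq_bigr => i _.
  have id : (i.+1 < n.+1)%N by rewrite ltnS.
  rewrite IH // ?(ltn_trans id) // gg //; apply: leq_ltn_trans nd.
  exact: leq_trans (leq_subr _ _) (leqnSn _).
split=> //; case: d d0 dk e gg gd pl => // d _ dk e gg gd pl.
rewrite !newton gd mulrnDl opprD -!addrA; congr (_ + _).
rewrite addrC; congr (_ - _); congr (- _); apply: eq_bigr => i _.
by rewrite pl ?ltnS // gg // ltnS leq_subr.
Qed.

(** Only the leading coefficient of [h] meets the [d]-th power sum, the first one that changes. *)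
Lemma root_sum_shift (h : {poly F}) k d (v w : 'rV[F]_k) (c : F) : (0 < d)%N -> (d <= k)%N ->
  size h = d.+1 -> monp w = monp v + c *: 'X^(k - d) ->
  root_sum h (monp w) = root_sum h (monp v) - emb (h`_d * c *+ d).
Proof.
move=> d0 dk sh e; have [pl pd] := power_sums_shift d0 dk e.
have rs u : root_sum h (@monp k u) =
    \sum_(i < d.+1) emb h`_i * \sum_(z <- roots (map_poly emb (monp u))) z ^+ i.
  under [RHS]eq_bigr => i _ do rewrite mulr_sumr.
  rewrite exchange_big /=; apply: eq_bigr => z _.
  rewrite horner_coef size_map_poly sh; apply: eq_bigr => i _.
  by rewrite coef_map.
rewrite !rs !big_ord_recr /= pd mulrBr addrA rmorphMn rmorphM mulrnAr; congr (_ + _ - _).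
by apply: eq_bigr => i _; rewrite pl.
Qed.

(** * The L-function *)

Variables (h : {poly F}) (psi : F -> algC).
Hypotheses (psi0 : psi 0 = 1) (psiD : forall a b, psi (a + b) = psi a * psi b).

(** Multiplicative on monic polynomials, hence the analogue of a Dirichlet character. *)
Definition chi (f : {poly F}) : algC := psi (emb_inv (root_sum h f)).

Lemma chiM f g : f \is monic -> g \is monic -> chi (f * g) = chi f * chi g.
Proof.
move=> fm gm; rewrite /chi root_sumM // -psiD; congr psi.
by rewrite -[in LHS](root_sum_embK h fm) -[in LHS](root_sum_embK h gm) -rmorphD embK.
Qed.

(** The trace of [h(a)] down to [F], for [a] in the field with [q ^ j] elements: [h] commutes with
    [frob]. *)
Definition trace_at j (a : K) : K := \sum_(i < j) (map_poly emb h).[a ^+ (q ^ i)].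

Definition char_sum j : algC := \sum_(a <- fixed_points j) psi (emb_inv (trace_at j a)).

Definition L_coef k : algC := \sum_(v : 'rV[F]_k) chi (monp v).

(** The roots of the norm polynomial are the conjugates of [a], and the sum of [h] over them is the
    trace. *)
Lemma chi_norm_poly j a : a ^+ (q ^ j) = a ->
  chi (poly_descent (norm_poly j a)) = psi (emb_inv (trace_at j a)).
Proof.
move=> aj; rewrite /chi; congr (psi (emb_inv _)).
rewrite (@root_sum_perm _ _ [seq a ^+ (q ^ i) | i <- iota 0 j]); last first.
  rewrite poly_descentK ?norm_poly_frob // big_map.
  by rewrite /norm_poly -(big_mkord xpredT (fun i => 'X - (a ^+ (q ^ i))%:P)) /index_iota subn0.
rewrite big_map /trace_at -(big_mkord xpredT (fun i => (map_poly emb h).[a ^+ (q ^ i)])).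
by rewrite /index_iota subn0.
Qed.

(** Summing [count_norm_poly] over the distinct roots of [f] gives the total multiplicity. This is
    the analogue of writing [log n] as a sum of the von Mangoldt function over divisors. *)
Lemma sum_mup_roots k (f : {poly F}) : f \is monic -> size f = k.+1 ->
  (\sum_(1 <= j < k.+1) count (fun a => (norm_poly j a %| map_poly emb f)%R) (fixed_points j) = k)%N.
Proof.
move=> fm sf; set g := map_poly emb f.
have gm : g \is monic by rewrite map_monic.
have sg : size (roots g) = k by apply/eqP; rewrite -eqSS -size_roots // size_map_poly sf.
have f0 : f != 0 by apply: monic_neq0.
transitivity (\sum_(1 <= j < k.+1) \sum_(a <- undup (roots g))
   ((a \in fixed_points j) && (norm_poly j a %| g)%R))%N.
  rewrite big_nat [RHS]big_nat; apply: eq_bigr => j /andP[j1 _].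
  rewrite -big_mkcond sum1_count -!size_filter; apply/perm_size/uniq_perm.
  - by rewrite filter_uniq // uniq_fixed_points.
  - by rewrite filter_uniq // undup_uniq.
  move=> a; rewrite !mem_filter mem_undup mem_roots // andbC -andbA; congr (_ && _).
  have [Ng|] := boolP (norm_poly j a %| g); last by [].
  rewrite /= -dvdp_XsubCl; apply/esym; apply: dvdp_trans Ng.
  by case: j j1 => // j _; rewrite /norm_poly big_ord_recl /= expn0 expr1 dvdp_mulr.
rewrite exchange_big /= -[RHS]sg.
under eq_bigr => a _ do rewrite (count_norm_poly _ fm sf) -/g (rootsE gm) mu_prod_XsubC.
have := big_undup_iterop_count addn (roots g) xpredT (fun=> 1%N).
rewrite sum1_size => <-; apply: eq_bigr => a _.
by rewrite Monoid.iteropE iter_addn_0 mul1n.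
Qed.

(** The relation [X L' = (sum of S_j X ^ j) L]: the factor [k] is expanded by [sum_mup_roots], and
    [chi] splits over each factorisation found. *)
Lemma L_coef_rec k : L_coef k *+ k = \sum_(1 <= j < k.+1) char_sum j * L_coef (k - j).
Proof.
transitivity (\sum_(v : 'rV[F]_k) \sum_(1 <= j < k.+1) \sum_(a <- fixed_points j)
   if (norm_poly j a %| map_poly emb (monp v))%R then chi (monp v) else 0).
  rewrite /L_coef -sumrMnl; apply: eq_bigr => v _.
  rewrite -[LHS](congr1 (fun n => _ *+ n) (sum_mup_roots (monp_monic v) (size_monp v))) -sumrMnr.
  by apply: eq_bigr => j _; rewrite -big_mkcond big_const_seq iter_addr addr0.
rewrite exchange_big /= big_nat [RHS]big_nat; apply: eq_bigr => j /andP[j1 jk].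
rewrite exchange_big /= /char_sum mulr_suml.
rewrite big_seq [RHS]big_seq; apply: eq_bigr => a; rewrite mem_fixed_points // => /eqP aj.
set N := poly_descent (norm_poly j a).
have hN : map_poly emb N = norm_poly j a by rewrite poly_descentK ?norm_poly_frob.
have Nm : N \is monic by rewrite -(map_monic emb) hN norm_poly_monic.
have N0 : N != 0 by apply: monic_neq0.
have sN : size N = j.+1 by rewrite -(size_map_poly emb) hN size_norm_poly.
rewrite -(chi_norm_poly aj) -/N /L_coef mulr_sumr.
under eq_bigr => v _ do rewrite -hN dvdp_map.
rewrite -big_mkcond /=.
have kj : (k = j + (k - j))%N by rewrite subnKC // -ltnS.
have sNw (w : 'rV[F]_(k - j)) : size (N * monp w) = k.+1.
  by rewrite size_mul ?monic_neq0 ?monp_monic // sN size_monp addSn addnS /= -kj.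
have mNw (w : 'rV[F]_(k - j)) : N * monp w \is monic by rewrite monicMl // monp_monic.
(* The monic multiples of [N] of degree [k] are the [N * w] with [w] monic of degree [k - j]. *)
rewrite (reindex_onto (fun w : 'rV[F]_(k - j) => monp_inv k (N * monp w))
   (fun v => monp_inv (k - j) (monp v %/ N))) /=; last first.
  move=> v Nv; have e : monp v = N * (monp v %/ N) by rewrite mulrC divpK.
  have mv : monp v %/ N \is monic by have := monp_monic v; rewrite {1}e monicMl.
  have sv : size (monp v %/ N) = (k - j).+1.
    have := size_monp v; rewrite {1}e size_mul ?monic_neq0 // sN addSn /= => hs.
    by apply/eqP; rewrite -(eqn_add2l j) hs addnS -kj.
  by rewrite monp_invK // -e monpK.
apply: eq_big => [w|w _].
  by rewrite monp_invK // dvdp_mulr //= mulKp // monpK eqxx.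
by rewrite monp_invK // chiM ?monp_monic.
Qed.

Lemma L_coef0 : L_coef 0 = 1.
Proof.
rewrite /L_coef (bigD1 0) //= big1 ?addr0; last first.
  by move=> v /eqP[]; apply/rowP => -[].
rewrite /chi /root_sum.
have -> : map_poly emb (@monp 0 0) = \prod_(z <- [::] : seq K) ('X - z%:P).
  by rewrite big_nil /monp raddf0 addr0 expr0 rmorph1.
rewrite (perm_big [::] (perm_roots erefl)) big_nil.
by rewrite -(rmorph0 emb) embK.
Qed.

(** With [c] chosen so that every root sum shifts by an [a] with [psi a != 1], translation permutes
    the monic polynomials and multiplies [L_coef k] by [psi a]. *)
Lemma L_coef_eq0 k d : size h = d.+1 -> (0 < d)%N -> (d <= k)%N -> d%:R != 0 :> F ->
  (exists a, psi a != 1) -> L_coef k = 0.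
Proof.
move=> sh d0 dk dF [a ha].
have hd : h`_d != 0 by rewrite -[d]/(d.+1.-1) -sh -lead_coefE lead_coef_eq0 -size_poly_eq0 sh.
pose c := - a / (h`_d *+ d).
have hd0 : h`_d *+ d != 0 by rewrite -mulr_natr mulf_neq0.
have hc : h`_d * c *+ d = - a by rewrite -mulrnAl mulrC divfK.
pose u : 'rV[F]_k := poly_rV (c *: 'X^(k - d)).
have hu v : monp (v + u) = monp v + c *: 'X^(k - d).
  rewrite /monp raddfD /= addrA poly_rV_K //.
  apply: leq_trans (size_scale_leq _ _) _; rewrite size_polyXn; move: d0 dk; lia.
have : L_coef k = L_coef k * psi a.
  rewrite {1}/L_coef (reindex_inj (addIr u)) /= /L_coef mulr_suml; apply: eq_bigr => v _.
  rewrite /chi (root_sum_shift d0 dk sh (hu v)) hc rmorphN opprK -psiD; congr psi.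
  by rewrite -{1}(root_sum_embK h (monp_monic v)) -rmorphD embK.
move/eqP; rewrite -subr_eq0 -{1}[L_coef k]mulr1 -mulrBr mulf_eq0 subr_eq0.
by rewrite [1 == _]eq_sym (negbTE ha) orbF => /eqP.
Qed.

(** The [ws] are the inverse roots of [L]. Up to sign, [L_coef_rec] and Newton's identities are the
    same recurrence, and [L_0 = 1] makes it determine the sums. *)
Lemma char_sum_power_sums d : size h = d.+1 -> (0 < d)%N -> d%:R != 0 :> F ->
  (exists a, psi a != 1) ->
  exists2 ws : seq algC, (size ws < d)%N &
    forall n, char_sum n.+1 = - \sum_(w <- ws) w ^+ n.+1.
Proof.
move=> sh d0 dF nt; pose L : {poly algC} := \poly_(k < d) L_coef k.
have Lk k : L`_k = L_coef k.
  by rewrite coef_poly; case: ltnP => // dk; rewrite (L_coef_eq0 sh).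
have L0 : L`_0 = 1 by rewrite Lk L_coef0.
have Ln0 : L != 0 by apply: contra_eq_neq L0 => ->; rewrite coef0 eq_sym oner_eq0.
have [r hr] := closed_field_poly_normal L.
have szr : (size r < d)%N.
  have := size_poly d L_coef; rewrite -/L {1}hr size_scale ?lead_coef_eq0 //.
  by rewrite size_prod_XsubC.
have rn0 z : z \in r -> z != 0.
  move=> zr; apply/negP => /eqP z0; have : root L z.
    by rewrite hr rootZ ?lead_coef_eq0 // root_prod_XsubC.
  by rewrite z0 rootE horner_coef0 L0 oner_eq0.
pose ws := map GRing.inv r.
have LE : L = \prod_(w <- ws) (1 - w *: 'X).
  pose c := lead_coef L * \prod_(z <- r) - z.
  have Lc : L = c *: \prod_(w <- ws) (1 - w *: 'X).
    rewrite {1}hr /c -scalerA; congr (_ *: _); rewrite big_map -scaler_prod.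
    rewrite big_seq [RHS]big_seq; apply: eq_bigr => z /rn0 z0.
    by rewrite scalerBr scalerA mulNr divff // scaleN1r opprK addrC scaleNr -mul_polyC mulr1.
  have : c = 1.
    have := L0; rewrite Lc coefZ coef_rev_prod_XsubC // subn0.
    have -> : size ws = (size (\prod_(z <- ws) ('X - z%:P))).-1 by rewrite size_prod_XsubC.
    by rewrite -lead_coefE lead_coef_prod_XsubC mulr1.
  by move=> c1; rewrite Lc c1 scale1r.
exists ws; first by rewrite size_map.
elim/ltn_ind => n IH.
have := newton_identity ws n; rewrite /= -LE big_ord_recr /= subnn L0 mulr1.
have := L_coef_rec n.+1; rewrite big_nat_recr //= subnn L_coef0 mulr1 -Lk => ->.
rewrite big_add1 /= big_mkord [X in X + _ + _](_ : _ = - \sum_(i < n) (\sum_(z <- ws) z ^+ i.+1) * L`_(n - i)).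
  by rewrite addrACA addNr add0r => /eqP; rewrite addr_eq0 => /eqP.
rewrite -sumrN; apply: eq_bigr => i _.
by rewrite IH // mulNr Lk subSS.
Qed.

(** * Growth of the character sums *)

Lemma trace_at_frob n x : x ^+ (q ^ n) = x -> frob (trace_at n x) = trace_at n x.
Proof.
move=> xn; rewrite /trace_at rmorph_sum /=.
have fr i : frob (map_poly emb h).[x ^+ (q ^ i)] = (map_poly emb h).[x ^+ (q ^ i.+1)].
  by rewrite -horner_map /= map_frob_emb /frob -exprM -expnSr.
under eq_bigr => i _ do rewrite fr.
case: n xn => [|n] xn; first by rewrite !big_ord0.
by rewrite big_ord_recr [RHS]big_ord_recl /= xn expn0 expr1 addrC.
Qed.

(** Provides the constant [c] for which the condition that the trace equal [t] becomes solvability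
    of [y ^ q - y = h(x) - c]. *)
Lemma trace_surj n (t : K) : (0 < n)%N -> exists c : K, \sum_(i < n) c ^+ (q ^ i) = t.
Proof.
case: n => // n _; pose P : {poly K} := \sum_(i < n.+1) 'X^(q ^ i) - t%:P.
have /closed_rootP[c] : size P != 1%N.
  have : P`_(q ^ n) = 1.
    rewrite coefB coefC -[_ == 0%N]negbK -lt0n card_field_gt0 subr0 coef_sum.
    rewrite big_ord_recr /= coefXn eqxx big1 ?add0r // => i _.
    by rewrite coefXn eqn_exp2l ?card_field_gt1 // gtn_eqF.
  move=> h1; apply/eqP => s1; move: h1; rewrite nth_default ?s1 ?card_field_gt0 //.
  by move/eqP; rewrite eq_sym oner_eq0.
rewrite rootE hornerD hornerN hornerC horner_sum subr_eq0 => /eqP <-; exists c.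
by apply: eq_bigr => i _; rewrite hornerXn.
Qed.

Lemma telescope_frob n (y : K) :
  \sum_(i < n) (y ^+ q - y) ^+ (q ^ i) = y ^+ (q ^ n) - y.
Proof.
elim: n => [|n IH]; first by rewrite big_ord0 expn0 expr1 subrr.
rewrite big_ord_recr /= IH exprB_card -exprM -expnS.
by rewrite addrC addrA subrK.
Qed.

(** Above each [x] of the fibre lie [q] rational points of an Artin-Schreier curve, the translates
    of one solution by [F], so Stepanov's bound applies. *)
Lemma trace_fibre_bound d r (t : F) : size h = d.+1 -> (0 < d)%N -> coprime q d ->
  ((q * d + 2) ^ 2 <= q ^ r)%N -> (0 < r)%N ->
  (q * count (fun x => emb_inv (trace_at (r + r) x) == t) (fixed_points (r + r)) <=
   q ^ r * q ^ r + (2 * (q * d) + 1) * q ^ r)%N.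
Proof.
move=> sh d0 co hs r0; have n0 : (0 < r + r)%N by rewrite addn_gt0 r0.
have [c hc] := trace_surj (emb t) n0.
rewrite -size_filter.
apply: (@stepanov_bound K q d _ (map_poly emb h - c%:P)) => //.
- exact: card_field_gt1.
- by rewrite size_polyDl size_map_poly sh // size_polyN (leq_ltn_trans (size_polyC_leq1 _)).
- by move=> a b; rewrite exprD_card.
- by rewrite filter_uniq // uniq_fixed_points.
move=> x; rewrite mem_filter mem_fixed_points // => /andP[/eqP xt /eqP xn].
rewrite -expnD; split=> //.
have [y0 hy0] : exists y0 : K, y0 ^+ q = y0 + (map_poly emb h - c%:P).[x].
  have /closed_rootP[y0] : size ('X^q - ('X + (map_poly emb h - c%:P).[x]%:P) : {poly K}) != 1%N.
    rewrite size_polyDl size_polyXn ?size_polyN ?size_XaddC ?ltnS ?card_field_gt1 //.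
    by rewrite eqSS -lt0n -[q]expn1 card_field_gt0.
  by rewrite rootE !hornerE subr_eq0 => /eqP e; exists y0; rewrite e !hornerE.
exists [seq y0 + emb a | a <- enum F]; split.
- rewrite map_inj_uniq ?enum_uniq // => a b /addrI; exact: fmorph_inj.
- by rewrite size_map -cardE.
move=> _ /mapP[a _ ->].
have ya : (y0 + emb a) ^+ q = y0 + emb a + (map_poly emb h - c%:P).[x].
  by rewrite -{1}[q]expn1 exprD_card expn1 hy0 -{1}[q]expn1 emb_card addrAC.
(* The telescoping sum equals the trace of [h(x)] minus [t], which vanishes, so [y] is rational. *)
split=> //; apply/eqP; rewrite -subr_eq0 -telescope_frob ya.
under eq_bigr => i _ do rewrite [y0 + _ + _]addrC addrK hornerD hornerN hornerC exprB_card.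
rewrite sumrB hc subr_eq0 -xt emb_invK ?trace_at_frob //; apply/eqP.
apply: eq_bigr => i _.
elim: (nat_of_ord i) => [|j IH]; first by rewrite expn0 !expr1.
rewrite expnSr exprM IH -/(frob _) -horner_map /= map_frob_emb /frob.
by rewrite -exprM.
Qed.

Lemma sum_psi : (exists a, psi a != 1) -> \sum_t psi t = 0.
Proof.
case=> a ha; have : \sum_t psi t = (\sum_t psi t) * psi a.
  rewrite {1}(reindex_inj (addIr a)) mulr_suml; apply: eq_bigr => t _; exact: psiD.
move/eqP; rewrite -subr_eq0 -{1}[\sum_t psi t]mulr1 -mulrBr mulf_eq0 subr_eq0.
by rewrite [1 == _]eq_sym (negbTE ha) orbF => /eqP.
Qed.

(** [psi a] is a [p]-th root of unity, as [p] annihilates [F]. *)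
Lemma norm_psi a : `|psi a| = 1.
Proof.
have hX n : psi (a *+ n) = psi a ^+ n.
  by elim: n => [|n IH]; rewrite ?mulr0n ?psi0 ?expr0 // mulrS psiD IH exprS.
have [p pp pF] := finPcharP F.
have := hX p; rewrite -mulr_natr (pcharf0 pF) mulr0 psi0 => /(congr1 Num.norm).
rewrite normr1 normrX => /esym/eqP; rewrite pexpr_eq1 ?prime_gt0 // => /eqP.
exact.
Qed.

(* The deviations [u t] of the fibre counts from their mean are bounded above
   and sum to zero, hence are also bounded in absolute value on average. *)
Lemma char_sum_growth d : size h = d.+1 -> (0 < d)%N -> coprime q d ->
  (exists a, psi a != 1) ->
  forall r, ((q * d + 2) ^ 2 < r)%N ->
  `|char_sum (r + r)| <= (2 * (2 * (q * d) + 1))%:R * q%:R ^+ r.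
Proof.
move=> sh d0 co nt r hr; have r0 : (0 < r)%N by apply: leq_ltn_trans hr.
have n0 : (0 < r + r)%N by rewrite addn_gt0 r0.
have hs : ((q * d + 2) ^ 2 <= q ^ r)%N.
  by apply/ltnW/(ltn_trans hr)/ltn_expl/card_field_gt1.
pose E := fixed_points (r + r).
pose N t := count (fun x => emb_inv (trace_at (r + r) x) == t) E.
pose s := (q ^ r)%N; pose C := (2 * (q * d) + 1)%N.
have bN t : (q * N t <= s * s + C * s)%N by apply: trace_fibre_bound.
have sN : (\sum_t N t = s * s)%N.
  have -> : (s * s = size E)%N.
    apply/eqP; rewrite -eqSS -size_roots ?monic_fixed_poly //.
    rewrite size_polyDl size_polyXn ?expnD // size_polyN size_polyX ltnS -expnD.
    by rewrite -[X in (X < _)%N](expn0 q) ltn_exp2l ?card_field_gt1.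
  rewrite -sum1_size; under eq_bigr => t _ do rewrite /N -sum1_count big_mkcond.
  rewrite exchange_big /=; apply: eq_bigr => x _.
  by rewrite -big_mkcond sum1_card (eq_card (B := pred1 (emb_inv (trace_at (r + r) x)))) ?card1 // => t; rewrite !inE eq_sym.
have cs : char_sum (r + r) = \sum_t (N t)%:R * psi t.
  rewrite /char_sum -/E.
  transitivity (\sum_(x <- E) \sum_t (if emb_inv (trace_at (r + r) x) == t then psi t else 0)).
    by apply: eq_bigr => x _; rewrite -big_mkcond (big_pred1 (emb_inv (trace_at (r + r) x))) // => t; rewrite /= eq_sym.
  rewrite exchange_big /=; apply: eq_bigr => t _.
  by rewrite -big_mkcond big_const_seq iter_addr addr0 mulr_natl.
pose u t : algC := (q * N t)%:R - (s * s)%:R.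
have ub t : u t <= (C * s)%:R by rewrite lerBlDl -natrD ler_nat.
have su : \sum_t u t = 0.
  rewrite sumrB -natr_sum -big_distrr /= sN sumr_const natrM mulr_natl -[#|_|]/q.
  by rewrite subrr.
have ur t : u t \is Num.real by rewrite rpredB ?realn.
(* Valid for either sign of [u t], and linear in it, so that summing over [t] removes the last
   term. *)
have nu t : `|u t| <= (2 * (C * s))%:R - u t.
  have := ub t; rewrite mulSn mul1n natrD => h1; have h0 : 0 <= (C * s)%:R :> algC by [].
  case: (real_ge0P (ur t)) => hu; first by rewrite lerBrDr lerD.
  by rewrite -[X in X <= _]add0r lerD // addr_ge0.
(* Subtracting the mean changes nothing, since [psi] sums to zero. *)
have qs : q%:R * char_sum (r + r) = \sum_t u t * psi t.
  under [RHS]eq_bigr => t _ do rewrite mulrBl natrM -mulrA.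
  by rewrite sumrB -!mulr_sumr -cs sum_psi // mulr0 subr0.
have q0 : 0 < q%:R :> algC by rewrite ltr0n ltnW // card_field_gt1.
rewrite -(ler_pM2l q0) -[X in X * `|_|](ger0_norm (ltW q0)) -normrM qs.
apply: le_trans (ler_norm_sum _ _ _) _.
apply: (@le_trans _ _ (\sum_t ((2 * (C * s))%:R - u t))).
  by apply: ler_sum => t _; rewrite normrM norm_psi mulr1.
rewrite sumrB su subr0 sumr_const -[#|_|]/q -[X in X <= _]mulr_natl ler_pM2l //.
by rewrite -natrX -natrM mulnA.
Qed.

Lemma sum_psi_horner : char_sum 1 = \sum_(a : F) psi h.[a].
Proof.
rewrite /char_sum (perm_big [seq emb a | a <- enum F]) /=.
  rewrite big_map -big_enum; apply: eq_bigr => a _.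
  by rewrite /trace_at big_ord1 expn0 expr1 horner_map embK.
apply: uniq_perm.
- exact: uniq_fixed_points.
- by rewrite map_inj_uniq ?enum_uniq //; apply: fmorph_inj.
move=> z; rewrite mem_fixed_points //; apply/eqP/mapP => [hz|[a _ ->]]; last exact: emb_card.
exists (emb_inv z); rewrite ?mem_enum // emb_invK //.
Qed.

Lemma weil_bound_closure d : size h = d.+1 -> (0 < d)%N -> coprime q d ->
  (exists a, psi a != 1) ->
  `|\sum_(a : F) psi h.[a]| ^+ 2 <= (d.-1 ^ 2 * q)%:R.
Proof.
move=> sh d0 co nt.
have dF : d%:R != 0 :> F.
  have [p pp pF] := finPcharP F; rewrite -(dvdn_pcharf pF).
  have := pnat_pchar_card 1; rewrite expn1.
  have pK : p \in [pchar K] by rewrite (fmorph_pchar emb).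
  rewrite (eq_pnat _ (pcharf_eq pK)) => /p_natP[m hm].
  have := card_field_gt1; move: co; rewrite hm; case: m {hm} => // m.
  by rewrite coprime_pexpl // prime_coprime.
have [ws szw hws] := char_sum_power_sums sh d0 dF nt.
have q0 : 0 < q%:R :> algC by rewrite ltr0n ltnW // card_field_gt1.
have wb w : w \in ws -> `|w| ^+ 2 <= q%:R.
  move=> hw; rewrite -normrX.
  (* The growth bound covers even indices only, so it is applied to the squares of the [w]. *)
  apply: (@power_sum_bound [seq w ^+ 2 | w <- ws] _ (2 * (2 * (q * d) + 1))%:R ((q * d + 2) ^ 2).+1 q0); last first.
    by apply/mapP; exists w.
  move=> r hr; rewrite big_map.
  have := char_sum_growth sh d0 co nt hr.
  case: r hr => // r hr; rewrite addSn hws normrN.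
  rewrite (eq_bigr (fun z => (z ^+ 2) ^+ r.+1)) // => z _.
  by rewrite -exprM; congr (z ^+ _); lia.
rewrite -sum_psi_horner hws normrN.
have wb' w : w \in ws -> `|w| <= sqrtC q%:R.
  move=> /wb hw; rewrite -(@ler_pXn2r _ 2) ?nnegrE ?sqrtC_ge0 ?ler0n //.
  by rewrite sqrtCK.
have : `|\sum_(w <- ws) w ^+ 1| <= (d.-1)%:R * sqrtC q%:R.
  apply: le_trans (ler_norm_sum _ _ _) _.
  apply: (@le_trans _ _ (\sum_(w <- ws) sqrtC q%:R)).
    by rewrite big_seq [X in _ <= X]big_seq; apply: ler_sum => w hw; rewrite expr1 wb'.
  rewrite big_const_seq count_predT iter_addr addr0 -[X in X <= _]mulr_natl ler_wpM2r ?sqrtC_ge0 ?ler0n //.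
  by rewrite ler_nat -ltnS prednK.
move=> hb; have sq0 : 0 <= sqrtC q%:R :> algC by rewrite sqrtC_ge0 ler0n.
have := @lerXn2r _ 2 _ _ _ _ hb; rewrite !nnegrE normr_ge0 mulr_ge0 // => /(_ isT isT).
by rewrite exprMn sqrtCK natrM natrX.
Qed.

End FrobeniusDescent.

(** * The Waring number *)

Lemma weil_bound (F : finFieldType) (h : {poly F}) (psi : F -> algC) (d : nat) :
  psi 0 = 1 -> (forall a b, psi (a + b) = psi a * psi b) -> (exists a, psi a != 1) ->
  size h = d.+1 -> (0 < d)%N -> coprime #|F| d ->
  `|\sum_(a : F) psi h.[a]| ^+ 2 <= (d.-1 ^ 2 * #|F|)%:R.
Proof.
move=> psi0 psiD nt sh d0 co; have [K [emb _]] := countable_algebraic_closure F.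
exact: (@weil_bound_closure F K emb).
Qed.

(** A nonzero coordinate form from [F] to the prime field, followed by powers of a primitive [p]-th
    root of unity. *)
Lemma additive_character_exists (F : finFieldType) : exists psi : F -> algC,
  [/\ psi 0 = 1, forall a b, psi (a + b) = psi a * psi b & exists a, psi a != 1].
Proof.
have [p pp pF] := finPcharP F; have p0 := prime_gt0 pp.
pose V : vectType 'F_p := pPrimeCharType pF.
pose b := vbasis (fullv : {vspace V}).
have bb : basis_of fullv b := vbasisP _.
have dim0 : (0 < \dim (fullv : {vspace V}))%N.
  rewrite lt0n dimv_eq0; apply/negP => /eqP h.
  have : (1 : pPrimeCharType pF) \in (fullv : {vspace V}) by apply: memvf.
  by rewrite h memv0 => /eqP; apply/eqP; exact: oner_neq0.
pose l (x : F) : 'F_p := coord b (Ordinal dim0) (x : V).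
have lD x y : l (x + y) = l x + l y by exact: linearD.
have [z hz] := C_prim_root_exists p0.
have zp : z ^+ p = 1 := prim_expr_order hz.
exists (fun x => z ^+ l x); split.
- by rewrite (_ : l 0 = 0) ?expr0 //; apply: linear0.
- move=> x y; rewrite lD -exprD -[RHS](prim_expr_mod hz) /=.
  congr (_ ^+ (_ %% _)%N). exact: Fp_cast.
- have lb : l (nth (0 : V) b 0) = 1.
    have := coord_free (Ordinal dim0) (Ordinal dim0) (basis_free bb).
    by rewrite eqxx; exact.
  exists (nth (0 : V) b 0); rewrite lb.
  have -> : (1 : 'F_p) = 1%N :> nat by rewrite /= modn_small // Fp_cast // prime_gt1.
  by rewrite expr1 -(prim_order_dvd hz 1) dvdn1 gtn_eqF // prime_gt1.
Qed.

(** If [beta] were missed, orthogonality would make the sum of [psi(- a beta) (S a) ^ m] over [a]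
    vanish; its term [q ^ m] at [a = 0] would then be at most the other [q - 1] terms together. The
    inequality assumed is squared to avoid [sqrt q]. *)
Lemma waring_solvable_of_weil (F : finFieldType) (h : {poly F}) (d m : nat) :
  size h = d.+1 -> (0 < d)%N -> coprime #|F| d ->
  (#|F| ^ 2 * (d.-1 ^ 2 * #|F|) ^ m <= #|F| ^ (2 * m))%N -> waring_solvable h m.
Proof.
move=> sh d0 co le beta; set q := #|F| in co le.
have [psi [psi0 psiD nt]] := additive_character_exists F.
have [[x hx]|no] := boolp.pselect (exists x : {ffun 'I_m -> F}, \sum_(i < m) h.[x i] = beta).
  by exists x.
exfalso; pose S a := \sum_(x : F) psi (a * h.[x]).
have S0 : S 0 = q%:R.
  rewrite /S; under eq_bigr => x _ do rewrite mul0r psi0.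
  by rewrite sumr_const.
have Sb a : a != 0 -> `|S a| ^+ 2 <= (d.-1 ^ 2 * q)%:R.
  (* [a * h] again has degree [d]. *)
  move=> a0; rewrite /S; under eq_bigr => x _ do rewrite -hornerZ.
  by apply: (weil_bound psi0 psiD nt) => //; rewrite size_scale.
have orth z : z != 0 -> \sum_a psi (a * z) = 0.
  by move=> z0; rewrite -[RHS](sum_psi psiD nt) [RHS](reindex_inj (mulIf z0)).
have psi_sum (I : finType) (f : I -> F) : psi (\sum_i f i) = \prod_i psi (f i).
  exact: (big_morph psi psiD psi0).
have npsi a : `|psi a| = 1 by apply: norm_psi.
have : \sum_a psi (- (a * beta)) * S a ^+ m = 0.
  transitivity (\sum_(x : {ffun 'I_m -> F}) \sum_a psi (a * (\sum_(i < m) h.[x i] - beta))).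
    rewrite exchange_big /=; apply: eq_bigr => a _.
    rewrite -[m in LHS]card_ord -prodr_const bigA_distr_bigA mulr_sumr.
    apply: eq_bigr => x _; rewrite mulrBr addrC psiD; congr (_ * _).
    by rewrite mulr_sumr psi_sum.
  apply: big1 => x _; apply: orth; rewrite subr_eq0; apply/negP => /eqP e.
  by case: no; exists x.
rewrite (bigD1 0) //= mul0r oppr0 psi0 mul1r S0 => /eqP; rewrite addr_eq0 => /eqP h1.
have q1 : (1 < q)%N by exact: finNzRing_gt1.
have hb : q%:R ^+ m <= \sum_(a : F | a != 0) (`|S a| ^+ m).
  have : q%:R ^+ m = `|q%:R ^+ m| :> algC by rewrite ger0_norm // exprn_ge0.
  move=> ->; rewrite h1 normrN; apply: le_trans (ler_norm_sum _ _ _) _.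
  by apply: ler_sum => a _; rewrite normrM npsi mul1r normrX.
pose B : algC := sqrtC (d.-1 ^ 2 * q)%:R.
have B0 : 0 <= B by rewrite sqrtC_ge0.
have SB a : a != 0 -> `|S a| <= B.
  by move=> /Sb; rewrite -(sqrtCK (d.-1 ^ 2 * q)%:R) ler_pXn2r // nnegrE.
have hb2 : q%:R ^+ m <= (q.-1)%:R * B ^+ m.
  apply: le_trans hb _.
  apply: (@le_trans _ _ (\sum_(a : F | a != 0) B ^+ m)).
    by apply: ler_sum => a /SB; apply: lerXn2r; rewrite nnegrE.
  rewrite sumr_const mulr_natl (_ : #|_| = q.-1) //.
  by rewrite -(cardC1 (0 : F)); apply: eq_card.
have : (q%:R ^+ m) ^+ 2 <= ((q.-1)%:R * B ^+ m) ^+ 2 :> algC.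
  by apply: lerXn2r hb2; rewrite nnegrE ?mulr_ge0 ?exprn_ge0.
rewrite exprMn -[(B ^+ m) ^+ 2]exprM mulnC exprM sqrtCK -!natrX -natrM ler_nat.
rewrite -expnM mulnC => h2; have := leq_trans le h2; rewrite leqNgt => /negP; apply.
(* Positivity lets [q - 1 < q] give a strict inequality, contradicting [le]. *)
have D0 : (0 < (d.-1 ^ 2 * q) ^ m)%N.
  have : (0 < q ^ (2 * m))%N by rewrite expn_gt0 ltnW.
  move/leq_trans => /(_ _ h2); rewrite muln_gt0 => /andP[] //.
by rewrite ltn_pmul2r // ltn_exp2r // prednK // ltnW.
Qed.

(** Exponentiation gives [q ^ 2 <= (q / D ^ 2) ^ m]; the denominator is positive since
    [D ^ 2 < q]. *)
Lemma waring_exponent (R : realType) (q D m : nat) : (0 < D)%N -> (D ^ 2 < q)%N ->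
  ln ((q%:R : R) ^+ 2) / ln (q%:R / D%:R ^+ 2) <= m%:R -> (q ^ 2 * D ^ (2 * m) <= q ^ m)%N.
Proof.
move=> D0 Dq; have q0 : 0 < q%:R :> R by rewrite ltr0n (leq_ltn_trans _ Dq).
have D20 : 0 < (D%:R : R) ^+ 2 by rewrite exprn_gt0 // ltr0n.
have r0 : 0 < q%:R / D%:R ^+ 2 :> R by rewrite divr_gt0.
have l0 : 0 < ln (q%:R / D%:R ^+ 2 : R).
  by rewrite ln_gt0 // ltr_pdivlMr // mul1r -natrX ltr_nat.
rewrite ler_pdivrMr // mulrC mulr_natr -lnXn // ler_ln ?posrE ?exprn_gt0 //.
have D2m : 0 < ((D%:R : R) ^+ 2) ^+ m by exact: exprn_gt0.
by rewrite expr_div_n ler_pdivlMr // -!natrX -natrM ler_nat expnM.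
Qed.

Theorem theorem4p16 (R : realType) (n d q p : nat) (F : finFieldType)
    (hn : (3 <= n)%N) (hd : (4 <= d)%N)
    (hq : #|F| = q) (hp : p \in [pchar F]) (hpd : ~~ (p %| d)%N)
    (hqd : ((d + 2)%:R : R) `^ (2 * (d%:R - 1) / (d%:R - 3)) < q%:R)
    (h : {poly F}) (hh : size h = d.+1) :
  exists g : nat, is_waring_number h g /\
    g%:Z <= Num.ceil (ln ((q%:R : R) ^+ 2) / ln ((q%:R : R) / (d + 2)%:R ^+ 2)).
Proof.
have d0 : (0 < d)%N by apply: leq_trans hd.
(* The exponent [2 (d - 1) / (d - 3)] is at least [2]. *)
have Dq : ((d + 2) ^ 2 < q)%N.
  rewrite -(ltr_nat R) natrX; apply: le_lt_trans hqd.
  rewrite -powR_mulrn // ler_powR //; first by rewrite ler1n addn_gt0 d0.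
  have d3 : 3 < d%:R :> R by rewrite ltr_nat.
  by rewrite ler_pdivlMr ?subr_gt0 //; lra.
have co : coprime #|F| d.
  have pp := pcharf_prime hp.
  have := abelian.abelem_pgroup (abelian.fin_ring_pchar_abelem hp).
  rewrite /pgroup.pgroup cardsT => /p_natP[m ->].
  by rewrite coprimeXl // prime_coprime.
set x := (_ / _ : R).
have x0 : 0 <= x.
  have q0 : 0 < q%:R :> R by rewrite ltr0n (leq_ltn_trans _ Dq).
  rewrite /x divr_ge0 // ln_ge0 //.
    by rewrite exprn_ege1 // ler1n (leq_ltn_trans _ Dq).
  by rewrite ler_pdivlMr ?exprn_gt0 ?ltr0n ?addn_gt0 ?d0 // mul1r -natrX ler_nat ltnW.
pose m := `|Num.ceil x|%N.
(* The absolute value is harmless because the ceiling is nonnegative. *)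
have mE : m%:Z = Num.ceil x.
  by rewrite /m gez0_abs // ceil_ge0 // (lt_le_trans _ x0) // ltrN10.
have xm : x <= m%:R by rewrite -[m%:R]/(m%:Z%:~R) mE ceil_ge.
have solv : waring_solvable h m.
  apply: (waring_solvable_of_weil hh d0 co); rewrite hq.
  (* This gives [q ^ 2 * (d + 2) ^ (2 m) <= q ^ m], stronger than what Weil's bound with [d - 1]
     requires. *)
  have le := waring_exponent (_ : 0 < d + 2)%N Dq xm.
  rewrite expnMn mulnA [in X in (_ <= X)%N]mulSn mul1n expnD leq_mul2r; apply/orP; right.
  apply: leq_trans (le _); last by rewrite addn_gt0 d0.
  rewrite leq_mul2l -expnM; apply/orP; right.
  case: m {mE xm le} => // m; rewrite leq_exp2r //; lia.
have ex : exists k, boolp.asbool (waring_solvable h k) by exists m; apply/boolp.asboolP.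
have [g /boolp.asboolP hg gmin] := ex_minnP ex; exists g; split.
  by split=> // k hk; apply: gmin; apply/boolp.asboolP.
by rewrite -mE lez_nat; apply: gmin; apply/boolp.asboolP.
Qed.
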